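(* Let $\{a_k\}_{k=0}^{\infty}$ be a sequence of complex numbers and let $b_n = \sum_{k=0}^{n}\binom{n}{k}(-1)^{k-1}a_k$ for $n\ge 0$. Then for every positive integer $p$ and every integer $n\geq p$, $$\sum_{k=0}^{n}\binom{n}{k}(-1)^{k-1}k^p a_k=(n\nabla)^p b_n .$$
   Context: The binomial transform of a sequence $\{a_k\}_{k\ge0}$ is the sequence $\{b_n\}_{n\ge0}$ with $b_n=\sum_{k=0}^{n}\binom{n}{k}(-1)^{k-1}a_k$ (the $k=0$ factor $(-1)^{-1}$ equals $-1$). The backward difference is $\nabla b_n=b_n-b_{n-1}$. The operator $n\nabla$ sends a sequence $b$ to the sequence whose $n$-th term is $n(b_n-b_{n-1})$; its domain index set loses the smallest index at each application. $(n\nabla)^p$ is the $p$-fold iterate: $(n\nabla)^0b_n=b_n$ and $(n\nabla)^{p}b_n=n\big(c_n-c_{n-1}\big)$ where $c_m=(m\nabla)^{p-1}b_m$. Thus $(n\nabla)^p b_n$ is defined for $n\ge p$, and it involves $b_{n-p},\dots,b_n$. *)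

(* Defs.v *)
From mathcomp Require Import all_boot all_order all_algebra.
From mathcomp Require Import reals.
From mathcomp.real_closed Require Import complex.
Set Implicit Arguments.
Unset Strict Implicit.
Unset Printing Implicit Defensive.
Import Order.TTheory GRing.Theory Num.Theory.
Local Open Scope ring_scope.

(* The exponent k - 1 is an integer: at k = 0 the sign is (-1)^-1 = -1. *)
Definition binomial_transform (R : realType) (a : nat -> R[i]) (n : nat) :
    R[i] :=
  \sum_(0 <= k < n.+1) 'C(n, k)%:R * (-1) ^ (k%:Z - 1) * a k.

(* Sequences are total on nat.  The backward difference at index 0 is a
   default value (0, since 0.-1 = 0), whereas the mathematical operator drops
   the smallest index at each application; hence [iter p nnabla b n] depends
   on no default value as soon as p <= n: it involves b (n - p), ..., b n. *)
Definition nabla (R : realType) (b : nat -> R[i]) (n : nat) : R[i] :=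
  b n - b n.-1.

Definition nnabla (R : realType) (b : nat -> R[i]) (n : nat) : R[i] :=
  n%:R * nabla b n.

(* Main.v *)
Require Import Defs.
From mathcomp Require Import all_boot all_order all_algebra.
From mathcomp Require Import reals.
From mathcomp.real_closed Require Import complex.
Set Implicit Arguments.
Unset Strict Implicit.
Unset Printing Implicit Defensive.
Import Order.TTheory GRing.Theory Num.Theory.
Local Open Scope ring_scope.

(** The binomial transform turns multiplication of [a] by its index into the
operator [nnabla] on the transform: this is [nnabla_binomial_transform], and
iterating it [p] times gives the theorem.  Comparing the coefficients of
[a k], it amounts to the absorption identity
[n * ('C(n, k) - 'C(n.-1, k)) = k * 'C(n, k)], which is [mul_bin_pred].  At
[n = 0] both sides of the intertwining vanish, so that the default value of
the difference at index 0 does no harm, and the induction on [p] can be run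
over all [n] at once. *)

(** Pascal's rule followed by [n * 'C(n.-1, k.-1) = k * 'C(n, k)]; written
additively because subtraction on [nat] is truncated. *)
Lemma mul_bin_pred (n k : nat) :
  (n * 'C(n, k) = n * 'C(n.-1, k) + k * 'C(n, k))%N.
Proof.
case: k => [|k]; first by rewrite !bin0 mul0n addn0.
case: n => [|n]; first by rewrite bin_small // !mul0n muln0.
by rewrite {1}binS mulnDr -(mul_bin_diag n.+1 k).
Qed.

(** Binomial coefficients vanish beyond the diagonal, so transforms at
different indices can be written as sums over a common range. *)
Lemma binomial_transform_widen (R : realType) (a : nat -> R[i]) (m n : nat) :
  (m <= n)%N ->
  binomial_transform a m =
    \sum_(0 <= k < n.+1) 'C(m, k)%:R * (-1) ^ (k%:Z - 1) * a k.
Proof.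
move=> le_mn; rewrite /binomial_transform (@big_cat_nat _ _ _ m.+1 0 n.+1) //=.
rewrite [X in _ = _ + X]big_nat [X in _ = _ + X]big1 ?addr0 // => k.
case/andP=> lt_mk _.
by rewrite bin_small // !mul0r.
Qed.

Lemma nnabla_binomial_transform (R : realType) (a : nat -> R[i]) (n : nat) :
  nnabla (binomial_transform a) n =
    binomial_transform (fun k => k%:R * a k) n.
Proof.
rewrite /nnabla /nabla (binomial_transform_widen a (leq_pred n)).
rewrite /binomial_transform -sumrB mulr_sumr; apply: eq_bigr => k _.
rewrite -!mulrBl !mulrA mulrBr -!natrM mul_bin_pred natrD addrC addKr natrM.
by congr (_ * _); rewrite [RHS]mulrAC [k%:R * _]mulrC.
Qed.

Lemma iter_nnabla_binomial_transform (R : realType) (a b : nat -> R[i])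
    (hb : forall n : nat, b n = binomial_transform a n) (p n : nat) :
  iter p (@nnabla R) b n = binomial_transform (fun k => k%:R ^+ p * a k) n.
Proof.
elim: p n => [|p IHp] n.
  by rewrite /= hb; apply: eq_bigr => k _; rewrite expr0 mul1r.
rewrite iterS /nnabla /nabla !IHp.
rewrite -[LHS]/(nnabla (binomial_transform (fun k => k%:R ^+ p * a k)) n).
rewrite nnabla_binomial_transform.
by apply: eq_bigr => k _; rewrite exprS !mulrA.
Qed.

Theorem mainTheorem1 (R : realType) (a b : nat -> R[i])
    (hb : forall n : nat, b n = binomial_transform a n)
    (p : nat) (hp : (0 < p)%N) (n : nat) (hn : (p <= n)%N) :
  \sum_(0 <= k < n.+1) 'C(n, k)%:R * (-1) ^ (k%:Z - 1) * k%:R ^+ p * a k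
  = iter p (@nnabla R) b n.
Proof.
rewrite (iter_nnabla_binomial_transform hb).
by apply: eq_bigr => k _; rewrite !mulrA.
Qed.
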